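(* Let $k\ge 1$ and let $T$ be a $k$-tree with $n$ vertices such that $n>k$. Then the Smith normal form of the $k$-th Laplacian matrix $L^k(T)$ is $$I_{n-k}\oplus (k+1)I_{(n-k)(k-1)}\oplus[0],$$ where $I_m$ denotes the $m\times m$ identity matrix and $\oplus$ denotes the block-diagonal direct sum of matrices.
   Context: A $k$-tree is either a complete graph on $k$ vertices or a graph obtained from a smaller $k$-tree by adjoining a new vertex together with $k$ edges connecting it to all vertices of a $k$-clique of the smaller $k$-tree. A $d$-clique is a set of $d$ pairwise adjacent vertices. A $k$-tree is regarded as a simplicial complex in which all cliques are simplices. Two distinct $k$-cliques $\alpha,\alpha'$ of $T$ are adjacent if some $(k+1)$-clique of $T$ contains both. The degree $\deg(\alpha)$ of a $k$-clique is the number of $k$-cliques adjacent to it. If $\alpha_1,\dots,\alpha_c$ are the $k$-cliques of $T$, then $L^k(T)=\operatorname{diag}(\deg(\alpha_1),\dots,\deg(\alpha_c))-A^k(T)$, where $A^k(T)$ is the $c\times c$ matrix with $(i,j)$-entry $1$ if $\alpha_i,\alpha_j$ are adjacent and $0$ otherwise. The Smith normal form of an integer matrix $M$ is the unique diagonal matrix $\operatorname{diag}(f_1,\dots,f_r,0,\dots,0)$ with positive $f_i$, $f_i\mid f_j$ for $i<j$, $r=\operatorname{rank}(M)$, of the form $PMQ$ with $P,Q$ integer unimodular matrices. *)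

(* Defs.v *)
From mathcomp Require Import all_boot all_order all_algebra.
Set Implicit Arguments.
Unset Strict Implicit.
Unset Printing Implicit Defensive.
Import Order.TTheory GRing.Theory Num.Theory.
Local Open Scope ring_scope.

Definition clique (V : finType) (e : rel V) (d : nat) (A : {set V}) : bool :=
  (#|A| == d) && [forall x in A, forall y in A, (x != y) ==> e x y].

Definition cliques (V : finType) (e : rel V) (d : nat) : {set {set V}} :=
  [set A : {set V} | clique e d A].

(* [ktree_on e k S] says that the subgraph of [e] induced on [S] is a k-tree.
   In [ktree_adjoin], the neighbours of the new vertex [v] within [S] are
   exactly the vertices of the k-clique [Q]. *)
Inductive ktree_on (V : finType) (e : rel V) (k : nat) : {set V} -> Prop :=
| ktree_complete (K : {set V}) of clique e k K : ktree_on e k K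
| ktree_adjoin (S Q : {set V}) (v : V) of
    ktree_on e k S & v \notin S & Q \subset S & clique e k Q &
    {in S, forall u, e v u = (u \in Q)} : ktree_on e k (v |: S).

Definition ktree (V : finType) (e : rel V) (k : nat) : Prop :=
  ktree_on e k [set: V].

Definition clique_adj (V : finType) (e : rel V) (k : nat) : rel {set V} :=
  fun a b =>
    (a != b) && [exists c in cliques e k.+1, (a \subset c) && (b \subset c)].

Definition clique_deg (V : finType) (e : rel V) (k : nat) (a : {set V}) : nat :=
  #|[set b in cliques e k | clique_adj e k a b]|.

Definition clique_adjmx (V : finType) (e : rel V) (k c : nat)
    (alpha : c.-tuple {set V}) : 'M[int]_c :=
  \matrix_(i, j) (clique_adj e k (tnth alpha i) (tnth alpha j))%:R.

Definition clique_laplacian (V : finType) (e : rel V) (k c : nat)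
    (alpha : c.-tuple {set V}) : 'M[int]_c :=
  diag_mx (\row_i (clique_deg e k (tnth alpha i))%:R) - clique_adjmx e k alpha.

(* Entries of [f] beyond its length are 0, so the last clause describes
   diag(f_1, ..., f_r, 0, ..., 0). *)
Definition is_smith_normal_form (m n : nat) (M D : 'M[int]_(m, n)) : Prop :=
  (exists (P : 'M[int]_m) (Q : 'M[int]_n),
     [/\ P \in unitmx, Q \in unitmx & D = P *m M *m Q]) /\
  (exists f : seq int,
     [/\ forall i : nat, (i < size f)%N -> 0 < f`_i,
         forall i j : nat, (i < j < size f)%N -> (f`_i %| f`_j)%Z,
         size f = \rank (map_mx intr M : 'M[rat]_(m, n)) &
         D = \matrix_(i, j) (if i == j :> nat then f`_i else 0)]).

Definition direct_sum_mx (R : nzRingType) (m n : nat)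
    (A : 'M[R]_m) (B : 'M[R]_n) : 'M[R]_(m + n) := block_mx A 0 0 B.

(* Main.v *)
Require Import Defs.
From mathcomp Require Import all_boot all_order all_algebra.
From mathcomp Require Import perm zify.
Set Implicit Arguments.
Unset Strict Implicit.
Unset Printing Implicit Defensive.
Import Order.TTheory GRing.Theory Num.Theory.
Local Open Scope ring_scope.

(** Two adjacent [k]-cliques lie in a single [(k+1)]-clique, namely their union.
    Hence the [k]-th Laplacian of a graph is the sum, over its [(k+1)]-cliques
    [c], of the Laplacians of the complete graphs on the [k+1] facets of [c]
    ([clique_laplacianE]).

    Let a [k]-tree on [S] be extended by a vertex [v] attached to the [k]-clique
    [Q]. The only new [(k+1)]-clique is [c0 = v |: Q], and the new [k]-cliques are
    the [k] facets of [c0] other than [Q]. So the complexes are glued along the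
    single facet [Q], and in block form the new Laplacian is obtained from the old
    one by adding [k] at the position [(Q, Q)], bordering the row and the column of
    [Q] by entries [-1], and putting [M = (k+1) I - J], of size [k], in the lower
    right corner. The rows of [M] add up to the all-ones row; adding the new rows
    to the row of [Q], and likewise for columns, therefore removes the border as
    well as the extra [k] and leaves the direct sum of the old Laplacian and [M]
    ([facet_laplacian_glue]). In graph terms, the matrix is the Laplacian of a
    graph whose blocks are complete graphs, and [M] is the reduced Laplacian of
    such a block.

    A few row and column operations turn [M] into [diag(1, k+1, ..., k+1)] with
    [k-1] entries [k+1] ([reduced_complete_laplacian_form]). A single [k]-clique
    has Laplacian [(0)], so by induction a [k]-tree with [n] vertices has the
    diagonal form with [n-k] entries [1], [(n-k)(k-1)] entries [k+1] and one [0]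
    ([ktree_on_laplacian_form]). In increasing order for divisibility, these are
    the invariant factors. *)

(** * Diagonal forms under unimodular equivalence *)

(** The diagonal is a list, rather than a row vector, so that diagonals of blocks
    can be concatenated and permuted without casts between sizes. *)
Definition has_diagonal_form (R : comUnitRingType) (n : nat)
    (A : 'M[R]_n) (s : seq R) : Prop :=
  size s = n /\
  exists P Q : 'M[R]_n, [/\ P \in unitmx, Q \in unitmx &
    P *m A *m Q = diag_mx (\row_i s`_i)].

Lemma has_diagonal_form_diag (R : comUnitRingType) (n : nat) (s : n.-tuple R) :
  has_diagonal_form (diag_mx (\row_(i < n) s`_i)) s.
Proof.
split; first exact: size_tuple.
by exists 1%:M, 1%:M; rewrite unitmx1 mul1mx mulmx1.
Qed.

Lemma has_diagonal_form_equiv (R : comUnitRingType) (n : nat)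
    (A P Q : 'M[R]_n) (s : seq R) :
  P \in unitmx -> Q \in unitmx ->
  has_diagonal_form (P *m A *m Q) s -> has_diagonal_form A s.
Proof.
move=> uP uQ [sz [P' [Q' [uP' uQ' E]]]]; split=> //.
by exists (P' *m P), (Q *m Q'); rewrite !unitmx_mul uP uQ uP' uQ' -E !mulmxA.
Qed.

Lemma mul_perm_mx_tr (R : comUnitRingType) (n : nat) (p : 'S_n) (A : 'M[R]_n) :
  perm_mx p *m A *m (perm_mx p)^T = \matrix_(i, j) A (p i) (p j).
Proof.
rewrite tr_perm_mx -col_permE -row_permE.
by apply/matrixP=> i j; rewrite !mxE.
Qed.

(** Conjugating a diagonal matrix by a permutation matrix permutes its entries,
    so only the multiset of diagonal entries matters. *)
Lemma has_diagonal_form_perm (R : comUnitRingType) (n : nat)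
    (A : 'M[R]_n) (s t : seq R) :
  perm_eq t s -> has_diagonal_form A s -> has_diagonal_form A t.
Proof.
move=> st [sz [P [Q [uP uQ E]]]].
have szt : size t == n by rewrite (perm_size st) sz.
have szs : size s == n by rewrite sz.
have /tuple_permP[p tE] : perm_eq (Tuple szt) (Tuple szs) by [].
apply: (@has_diagonal_form_equiv _ _ A (perm_mx p *m P) (Q *m (perm_mx p)^T)).
- by rewrite unitmx_mul unitmx_perm.
- by rewrite unitmx_mul unitmx_tr unitmx_perm andbT.
have -> : perm_mx p *m P *m A *m (Q *m (perm_mx p)^T) = diag_mx (\row_i t`_i).
  rewrite !mulmxA -(mulmxA (perm_mx p) P A) -(mulmxA (perm_mx p) (P *m A) Q) E.
  rewrite mul_perm_mx_tr; apply/matrixP=> i j.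
  rewrite !mxE (inj_eq perm_inj); congr (_ *+ _).
  move: tE => /= ->; rewrite (nth_map i) ?size_enum_ord // nth_ord_enum.
  by rewrite (tnth_nth 0).
exact: (has_diagonal_form_diag (Tuple szt)).
Qed.

Lemma has_diagonal_form_block (R : comUnitRingType) (m n : nat)
    (A : 'M[R]_m) (B : 'M[R]_n) (s t : seq R) :
  has_diagonal_form A s -> has_diagonal_form B t ->
  has_diagonal_form (block_mx A 0 0 B) (s ++ t).
Proof.
move=> [szs [P [Q [uP uQ E]]]] [szt [P' [Q' [uP' uQ' E']]]].
split; first by rewrite size_cat szs szt.
exists (block_mx P 0 0 P'), (block_mx Q 0 0 Q').
rewrite !unitmxE !det_ublock !unitrM -!unitmxE uP uQ uP' uQ'; split=> //.
rewrite !mulmx_block !(mul0mx, mulmx0, addr0, add0r) E E' -diag_mx_row.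
congr diag_mx; apply/rowP=> i; rewrite !mxE nth_cat szs.
case: splitP => j ->; rewrite !mxE //.
by rewrite addKn.
Qed.

(** * Block elimination *)

Lemma block1_unitmx (R : comUnitRingType) (m n : nat) (W : 'M[R]_(m, n)) :
  block_mx 1%:M W 0 1%:M \in unitmx.
Proof. by rewrite unitmxE det_ublock !det1 mulr1 unitr1. Qed.

(** A Schur complement that needs no inverse of [M]: the factor [W] by which the
    last rows and columns are added to the first ones is known in advance. *)
Lemma has_diagonal_form_schur (R : comUnitRingType) (m n : nat)
    (A : 'M[R]_m) (M : 'M[R]_n) (W : 'M[R]_(m, n)) (s t : seq R) :
  has_diagonal_form A s -> has_diagonal_form M t ->
  has_diagonal_form
    (block_mx (A + W *m M *m W^T) (- (W *m M)) (- (M *m W^T)) M) (s ++ t).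
Proof.
move=> As Mt; have uW := block1_unitmx W.
apply: (has_diagonal_form_equiv uW (Q := (block_mx 1%:M W 0 1%:M)^T)).
  by rewrite unitmx_tr.
rewrite tr_block_mx !trmx0 !trmx1 !mulmx_block.
rewrite !(mul0mx, mulmx0, mul1mx, mulmx1, addr0, add0r).
rewrite mulmxN mulmxA addrK addNr mul0mx addr0 addNr.
exact: has_diagonal_form_block.
Qed.

(** The block that a [(k+1)]-clique contributes to the reduced Laplacian: the
    Laplacian of the complete graph on [k+1] vertices, without one vertex. *)
Definition reduced_complete_laplacian (k : nat) : 'M[int]_k :=
  k.+1%:Z%:M - const_mx 1.

(** Each column sums to [(k+1) - k = 1]. *)
Lemma const1_mul_reduced (k m : nat) :
  (const_mx 1 : 'M_(m, k)) *m reduced_complete_laplacian k = const_mx 1.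
Proof.
apply/matrixP=> i j; rewrite mulmxBr mul_mx_scalar !mxE.
under eq_bigr do rewrite !mxE mulr1.
by rewrite sumr_const card_ord; lia.
Qed.

(** Adding all other rows to the first one turns it into the all-ones row. Adding
    that row to each of the others cancels all entries [-1] and leaves an upper
    triangular matrix, whose first row is then cleared by the first column. *)
Lemma reduced_complete_laplacian_form (k : nat) :
  has_diagonal_form (reduced_complete_laplacian k.+1)
    (1 :: nseq k k.+2%:Z).
Proof.
pose one_row : 'rV[int]_k := const_mx 1.
pose P := block_mx 1%:M 0 one_row^T 1%:M *m block_mx 1%:M one_row 0 1%:M.
pose Q := block_mx 1%:M (- one_row) 0 1%:M.
have uP : P \in unitmx.
  rewrite unitmx_mul block1_unitmx andbT -unitmx_tr tr_block_mx.
  by rewrite !trmx1 trmx0 trmxK block1_unitmx.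
apply: (@has_diagonal_form_equiv _ (1 + k)%N (reduced_complete_laplacian k.+1)
          P Q _ uP (block1_unitmx _)).
have -> : (reduced_complete_laplacian k.+1 : 'M_(1 + k)) =
    block_mx k.+1%:Z%:M (- one_row) (- one_row^T) (k.+2%:Z%:M - const_mx 1).
  transitivity ((k.+2%:Z%:M : 'M_(1 + k)) - block_mx (const_mx 1)
      (const_mx 1) (const_mx 1) (const_mx 1)); first by rewrite block_mx_const.
  rewrite scalar_mx_block opp_block_mx add_block_mx !add0r.
  rewrite trmx_const; congr block_mx.
  by apply/matrixP=> i j; rewrite !ord1 !mxE /=; lia.
have oneT : one_row *m one_row^T = k%:Z%:M.
  apply/matrixP=> i j; rewrite !ord1 !mxE; under eq_bigr do rewrite !mxE mulr1.
  by rewrite sumr_const card_ord eqxx natz.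
have Tone : one_row^T *m one_row = const_mx 1.
  by apply/matrixP=> i j; rewrite !mxE big_ord1 !mxE mulr1.
have oneJ : one_row *m const_mx 1 = k%:Z *: one_row.
  apply/matrixP=> i j; rewrite !mxE; under eq_bigr do rewrite !mxE mulr1.
  by rewrite sumr_const card_ord; lia.
have -> : P *m block_mx k.+1%:Z%:M (- one_row) (- one_row^T)
            (k.+2%:Z%:M - const_mx 1) *m Q = block_mx 1 0 0 k.+2%:Z%:M.
  have addk : k.+1%:Z%:M - k%:Z%:M = 1%:M :> 'M[int]_1.
    by apply/matrixP=> i j; rewrite !ord1 !mxE; lia.
  have scalek : - one_row + (k.+2%:Z *: one_row - k%:Z *: one_row) = one_row.
    by apply/rowP=> i; rewrite !mxE; lia.
  rewrite /P /Q -2!mulmxA (mulmxA (block_mx 1%:M one_row 0 _)) mulmx_block.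
  rewrite !(mul0mx, mul1mx, add0r) mulmxN mulmxBr oneT oneJ mul_mx_scalar.
  rewrite addk scalek mulmxA mulmx_block.
  rewrite !(mul0mx, mul1mx, mulmx1, addr0) addrN Tone (addrC (const_mx 1)) subrK.
  rewrite mulmx_block.
  by rewrite !(mul0mx, mul1mx, mulmx1, mulmx0, addr0, add0r) addNr.
have -> : block_mx 1 0 0 k.+2%:Z%:M =
    diag_mx (\row_(i < 1 + k) (1 :: nseq k k.+2%:Z)`_i).
  rewrite -[X in block_mx X]diag_const_mx -[X in block_mx _ _ _ X]diag_const_mx.
  rewrite -diag_mx_row; congr diag_mx.
  apply/rowP=> i; rewrite !mxE; case: splitP => j ->; rewrite !mxE.
    by rewrite ord1.
  by rewrite /= nth_nseq ltn_ord.
have sz : size (1 :: nseq k k.+2%:Z) == (1 + k)%N by rewrite /= size_nseq.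
exact: (has_diagonal_form_diag (Tuple sz)).
Qed.

(** * Laplacians of families of facets *)

(** The summand at [c] is the Laplacian of the complete graph on the [k+1]
    facets of [c]; see [clique_laplacianE]. *)
Definition facet_laplacian (V : finType) (k : nat) (C : {set {set V}}) (m : nat)
    (alpha : m.-tuple {set V}) : 'M[int]_m :=
  \matrix_(i, j) let a := tnth alpha i in let b := tnth alpha j in
    \sum_(c in C) (k.+1%:Z *+ (a == b) - 1) *+ ((a \subset c) && (b \subset c)).

Lemma facet_laplacian_perm (V : finType) (k : nat) (C : {set {set V}})
    (m : nat) (alpha beta : m.-tuple {set V}) (s : seq int) :
  perm_eq beta alpha -> has_diagonal_form (facet_laplacian k C beta) s ->
  has_diagonal_form (facet_laplacian k C alpha) s.
Proof.
move=> /tuple_permP[p betaE] beta_s.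
have tnth_beta i : tnth beta i = tnth alpha (p i).
  rewrite (tnth_nth set0) betaE (nth_map i) ?size_enum_ord //.
  by rewrite nth_ord_enum.
apply: (@has_diagonal_form_equiv _ _ _ (perm_mx p) (perm_mx p)^T).
- exact: unitmx_perm.
- by rewrite unitmx_tr unitmx_perm.
rewrite mul_perm_mx_tr; congr has_diagonal_form: beta_s.
by apply/matrixP=> i j; rewrite !mxE !tnth_beta.
Qed.

(** The new simplex [c0] is glued along the single old facet [Q]. In the block
    form of the new Laplacian, [Q] is adjacent to every new facet, and adding the
    rows and columns of the new facets to those of [Q] undoes the gluing. *)
Lemma facet_laplacian_glue (V : finType) (k : nat) (C : {set {set V}})
    (c0 Q : {set V}) (m : nat) (alpha : m.-tuple {set V})
    (beta : k.+1.-tuple {set V}) (s : seq int) :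
  uniq alpha -> uniq beta -> Q \in alpha -> c0 \notin C ->
  {in alpha, forall a : {set V}, (a \subset c0) = (a == Q)} ->
  {in beta, forall b : {set V}, b \notin alpha /\ b \subset c0} ->
  {in beta & C, forall b c : {set V}, ~~ (b \subset c)} ->
  has_diagonal_form (facet_laplacian k.+1 C alpha) s ->
  has_diagonal_form (facet_laplacian k.+1 (c0 |: C) [tuple of alpha ++ beta])
    (s ++ 1 :: nseq k k.+2%:Z).
Proof.
move=> ua ub /tnthP[q ->] c0C old new newC As.
(* The multiplier of the elimination adds every new row to the row of [Q]. *)
pose W : 'M[int]_(m, k.+1) := delta_mx q 0 *m (const_mx 1 : 'rV_k.+1).
have WE i j : W i j = (i == q)%:R.
  by rewrite !mxE big_ord1 !mxE eqxx andbT mulr1.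
set M := reduced_complete_laplacian k.+1.
have WM : W *m M = W by rewrite -mulmxA const1_mul_reduced.
have MW : M *m W^T = W^T.
  have MT : M^T = M by apply/matrixP=> i j; rewrite !mxE eq_sym.
  by move/(congr1 trmx): WM; rewrite (trmx_mul W) MT.
have := has_diagonal_form_schur W As (reduced_complete_laplacian_form k).
congr has_diagonal_form; rewrite -/M MW WM.
have old_sub i : (tnth alpha i \subset c0) = (i == q).
  by rewrite old ?mem_tnth // (inj_eq (tuple_uniqP _ ua)).
have new_sub i : tnth beta i \subset c0 by have [] := new _ (mem_tnth i beta).
have old_new i j : (tnth alpha i == tnth beta j) = false.
  apply: contraNF (proj1 (new _ (mem_tnth j beta))) => /eqP <-.
  exact: mem_tnth.
have newC_sub i c : c \in C -> (tnth beta i \subset c) = false.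
  by move=> cC; apply: negbTE; apply: newC => //; apply: mem_tnth.
apply/matrixP=> i j.
rewrite [RHS]mxE /= big_setU1 //=.
case: (split_ordP i) => i' ->; case: (split_ordP j) => j' ->;
  rewrite ?(block_mxEul, block_mxEur, block_mxEdl, block_mxEdr);
  rewrite !(tnth_lshift, tnth_rshift) ?old_sub ?new_sub ?old_new.
- rewrite mxE [in LHS]mxE addrC; congr (_ + _).
  rewrite mxE; under eq_bigr do rewrite [W^T _ _]mxE !WE -natrM mulnb.
  rewrite sumr_const card_ord; case: (i' =P q) => [->|_]; last by rewrite mul0rn.
  case: (j' =P q) => [->|_]; last by rewrite mul0rn.
  by rewrite eqxx !mulr1n; lia.
- rewrite big1 => [|c cC]; last by rewrite newC_sub // andbF.
  by rewrite mxE WE andbT addr0 sub0r mulNrn.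
- rewrite big1 => [|c cC]; last by rewrite newC_sub.
  by rewrite mxE [W^T _ _]mxE WE addr0 (eq_sym (tnth beta i')) old_new sub0r mulNrn.
- rewrite big1 => [|c cC]; last by rewrite newC_sub.
  by rewrite !mxE addr0 (inj_eq (tuple_uniqP _ ub)).
Qed.

(** * Cliques and their facets *)

Lemma cliqueP (V : finType) (e : rel V) (d : nat) (A : {set V}) :
  reflect (#|A| = d /\ {in A &, forall x y, x != y -> e x y}) (clique e d A).
Proof.
apply: (iffP andP) => [[/eqP cA /forall_inP eA]|[/eqP cA eA]]; split=> //.
  by move=> x y xA yA; apply/implyP; move/forall_inP: (eA x xA); apply.
apply/forall_inP=> x xA; apply/forall_inP=> y yA; apply/implyP.
exact: eA.
Qed.

Lemma clique_subset (V : finType) (e : rel V) (d : nat) (A B : {set V}) :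
  clique e d A -> B \subset A -> clique e #|B| B.
Proof.
move=> /cliqueP[_ eA] /subsetP BA; apply/cliqueP; split=> //.
by move=> x y /BA xA /BA yA; apply: eA.
Qed.

Lemma card_other_facets (V : finType) (k : nat) (a c : {set V}) :
  #|a| = k -> #|c| = k.+1 -> a \subset c ->
  #|[set b : {set V} | b \subset c & #|b| == k] :\ a| = k.
Proof.
move=> ca cc ac.
have := cardsD1 a [set b : {set V} | b \subset c & #|b| == k].
by rewrite cards_draws cc binSn inE ac ca eqxx => -[].
Qed.

(** Two distinct [k]-sets can only lie in a common [(k+1)]-set if it is their
    union, so counting the common [(k+1)]-cliques amounts to testing adjacency. *)
Lemma card_common_cliques (V : finType) (e : rel V) (k : nat) (a b : {set V}) :
  a \in cliques e k -> b \in cliques e k -> a != b ->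
  #|[set c in cliques e k.+1 | (a \subset c) && (b \subset c)]| =
    clique_adj e k a b.
Proof.
rewrite !inE => /cliqueP[ca _] /cliqueP[cb _] ab.
have union c : c \in cliques e k.+1 -> a \subset c -> b \subset c -> c = a :|: b.
  rewrite inE => /cliqueP[cc _] ac bc; apply/esym/eqP.
  rewrite eqEcard subUset ac bc cc /=.
  have : a \proper a :|: b.
    rewrite properEneq subsetUl andbT; apply: contraNneq ab => aU.
    by rewrite eq_sym eqEcard ca cb leqnn andbT aU subsetUr.
  by move/proper_card; rewrite ca.
rewrite /clique_adj ab /=; case: exists_inP => [[c cC /andP[ac bc]]|no].
  apply/eqP/cards1P; exists c; apply/setP=> c'; rewrite in_set in_set1.
  apply/andP/eqP => [[c'C /andP[ac' bc']]|->]; last by rewrite ac bc.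
  by rewrite (union c') // (union c).
apply/eqP; rewrite cards_eq0; apply/eqP/setP=> c; rewrite in_set in_set0.
by apply/negP=> /andP[cC abc]; apply: no; exists c.
Qed.

(** Double counting of the pairs of a [(k+1)]-clique [c] above [a] and a facet
    of [c] other than [a]. *)
Lemma clique_degE (V : finType) (e : rel V) (k : nat) (a : {set V}) :
  a \in cliques e k ->
  clique_deg e k a = (#|[set c in cliques e k.+1 | a \subset c]| * k)%N.
Proof.
move=> aC; have := aC; rewrite inE => /cliqueP[ca _].
rewrite /clique_deg -sum1_card.
transitivity (\sum_(b in cliques e k :\ a) \sum_(c in cliques e k.+1 |
    a \subset c) (b \subset c : nat))%N.
  rewrite [RHS](eq_bigr (fun b => clique_adj e k a b : nat)) => [|b].
    rewrite [RHS](big_setID [set b | clique_adj e k a b]) /=.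
    rewrite [X in (_ + X)%N]big1 ?addn0 => [|b]; last first.
      by rewrite !in_set => /andP[/negbTE->].
    apply: eq_big => b; rewrite !in_set; last by move=> /andP[_ ->].
    by rewrite in_set1 /clique_adj (eq_sym a b); case: (b == a); rewrite ?andbF.
  rewrite in_setD1 => /andP[ba bC].
  rewrite -card_common_cliques 1?eq_sym // -sum1_card big_mkcond.
  rewrite [RHS]big_mkcond /=; apply: eq_bigr => c _; rewrite !in_set.
  by case: (clique e k.+1 c); case: (a \subset c); case: (b \subset c).
rewrite exchange_big -sum_nat_const /=.
apply: eq_big => [c|c /andP[]]; first by rewrite !in_set.
rewrite inE => cC ac; have := cC => /cliqueP[cc _].
rewrite -[RHS](card_other_facets ca cc ac) -sum1_card big_mkcond.
rewrite [RHS]big_mkcond /=; apply: eq_bigr => b _.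
rewrite !in_setD1 !in_set; case: (b == a) => //=.
case: (boolP (b \subset c)) => [bc|_]; last by rewrite if_same.
suff -> : clique e k b = (#|b| == k) by [].
by apply/idP/eqP => [/cliqueP[]|<-] //; apply: clique_subset cC bc.
Qed.

Lemma clique_laplacianE (V : finType) (e : rel V) (k c : nat)
    (alpha : c.-tuple {set V}) :
  uniq alpha -> {subset alpha <= cliques e k} ->
  clique_laplacian e k alpha = facet_laplacian k (cliques e k.+1) alpha.
Proof.
move=> ua aC; apply/matrixP=> i j.
have iC := aC _ (mem_tnth i alpha); have jC := aC _ (mem_tnth j alpha).
rewrite !mxE /= (inj_eq (tuple_uniqP _ ua)) sumrMnr.
set N := (\sum_(_ in _) _)%N.
have -> : N = #|[set A in cliques e k.+1 |
                (tnth alpha i \subset A) && (tnth alpha j \subset A)]|.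
  rewrite -sum1_card [LHS]big_mkcond [RHS]big_mkcond; apply: eq_bigr => A _.
  by rewrite !in_set; case: (clique e k.+1 A) => //; case: (_ && _).
have [->|ij] := eqVneq i j; last first.
  rewrite card_common_cliques ?(inj_eq (tuple_uniqP _ ua)) //.
  by rewrite !mulr0n !sub0r mulNrn.
rewrite clique_degE // /clique_adj eqxx subr0 !mulr1n.
under [in RHS]eq_finset => A do rewrite andbb.
by rewrite natz intS addrAC subrr add0r mulnC PoszM -mulr_natr natz.
Qed.

(** * Adding a vertex to a k-tree *)

Definition cliques_in (V : finType) (e : rel V) (d : nat) (S : {set V}) :
    {set {set V}} := [set A in cliques e d | A \subset S].

(** All other vertices of a clique through [v] are neighbours of [v]. *)
Lemma cliques_in_adjoin_new (V : finType) (e : rel V) (d : nat)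
    (S Q A : {set V}) (v : V) :
  {in S, forall u, e v u = (u \in Q)} ->
  A \in cliques_in e d (v |: S) -> v \in A -> A \subset v |: Q.
Proof.
rewrite !inE => eQ /andP[/cliqueP[_ eA] /subsetP AS] vA.
apply/subsetP=> u uA; rewrite !inE; case: eqVneq => //= uv.
have := AS u uA; rewrite !inE (negbTE uv) /= => uS.
by rewrite -eQ // eA // eq_sym.
Qed.

Lemma cliques_in_adjoin_old (V : finType) (e : rel V) (d : nat)
    (S A : {set V}) (v : V) :
  v \notin A -> (A \in cliques_in e d (v |: S)) = (A \in cliques_in e d S).
Proof.
move=> vA; rewrite !in_set; congr (_ && _).
apply/idP/idP => [/subsetP AS|AS]; last exact: subset_trans AS (subsetUr _ _).
apply/subsetP=> u uA; have := AS u uA; rewrite !inE => /predU1P[uv|//].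
by rewrite -uv uA in vA.
Qed.

Lemma clique_adjoin (V : finType) (e : rel V) (k : nat)
    (S Q : {set V}) (v : V) :
  symmetric e -> v \notin S -> Q \subset S -> clique e k Q ->
  {in S, forall u, e v u = (u \in Q)} -> clique e k.+1 (v |: Q).
Proof.
move=> e_sym vS /subsetP QS /cliqueP[cQ eC] eQ.
have vQ : v \notin Q by apply: contra vS => /QS.
apply/cliqueP; split; first by rewrite cardsU1 vQ cQ.
move=> x y /setU1P[->|xQ] /setU1P[->|yQ]; rewrite ?eqxx // => xy.
- by rewrite eQ ?QS.
- by rewrite e_sym eQ ?QS.
exact: eC.
Qed.

(** * The Smith normal form *)

(** Here the tree is a [k.+1]-tree with [m] vertices outside the initial clique.
    Each of them contributes one factor [1] and [k] factors [k+2]; the [0] comes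
    from the initial clique. *)
Definition ktree_factors (k m : nat) : seq int :=
  nseq m 1 ++ nseq (m * k) k.+2%:Z ++ [:: 0].

Lemma ktree_on_laplacian_form (V : finType) (e : rel V) (k : nat)
    (S : {set V}) :
  symmetric e -> ktree_on e k.+1 S ->
  exists m c (alpha : c.-tuple {set V}),
    [/\ #|S| = (k.+1 + m)%N, uniq alpha, alpha =i cliques_in e k.+1 S &
      has_diagonal_form (facet_laplacian k.+1 (cliques_in e k.+2 S) alpha)
        (ktree_factors k m)].
Proof.
move=> e_sym; elim: S / => [K cK|S Q v _ [m [c [alpha [cS ua aE As]]]] vS QS cQ eQ].
  have /cliqueP[card_K _] := cK.
  exists 0, 1, [tuple K]; split=> //; first by rewrite addn0.
    move=> A; rewrite inE !in_set; apply/eqP/andP => [->|[/cliqueP[cA _] AK]].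
      by rewrite cK subxx.
    by apply/eqP; rewrite eqEcard AK card_K cA leqnn.
  have -> : cliques_in e k.+2 K = set0.
    apply/setP=> A; rewrite !in_set; apply/negP=> /andP[/cliqueP[cA _]].
    by move/subset_leq_card; rewrite card_K cA ltnn.
  have -> : facet_laplacian k.+1 set0 [tuple K] =
      diag_mx (\row_(i < 1) [tuple (0 : int)]`_i).
    by apply/matrixP=> i j; rewrite [LHS]mxE /= big_set0 !mxE !ord1 mul0rn.
  exact: has_diagonal_form_diag.
have /cliqueP[card_Q _] := cQ.
have vQ : v \notin Q by apply: contra vS; apply/subsetP.
have cc0 := clique_adjoin e_sym vS QS cQ eQ.
have [card_c0 _] := cliqueP _ _ _ cc0.
(* The new cliques are taken to be the facets of [v |: Q] other than [Q], which
   gives their number at once. *)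
pose new := [set b : {set V} | b \subset v |: Q & #|b| == k.+1] :\ Q.
have card_new : #|new| = k.+1.
  exact: card_other_facets card_Q card_c0 (subsetUr _ _).
have new_v b : b \in new -> v \in b.
  rewrite !inE => /andP[bQ /andP[bc /eqP cb]]; apply: contraNT bQ => vb.
  rewrite eqEcard cb card_Q leqnn andbT; apply/subsetP=> x xb.
  by have := subsetP bc x xb; rewrite !inE => /predU1P[xv|//]; rewrite -xv xb in vb.
have sz_new : size (enum new) == k.+1 by rewrite -cardE card_new.
pose beta := Tuple sz_new.
have newE b : (b \in beta) = (b \in new) by rewrite mem_enum.
have old_v d A : A \in cliques_in e d S -> v \notin A.
  by rewrite !inE => /andP[_ /subsetP AS]; apply: contra vS => /AS.
have Qa : Q \in alpha by rewrite aE !in_set cQ.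
exists m.+1, (c + k.+1)%N, [tuple of alpha ++ beta]; split.
- by rewrite cardsU1 vS cS add1n addnS.
- rewrite cat_uniq ua enum_uniq andbT /=; apply/hasPn=> b; rewrite newE => bn.
  by apply/negP=> /=; rewrite aE => /old_v; rewrite new_v.
- move=> A; rewrite mem_cat aE newE.
  have [vA|vA] := boolP (v \in A); last first.
    by rewrite (cliques_in_adjoin_old _ _ _ vA) orbC (contraNF (new_v A)).
  rewrite (contraTF (@old_v _ A)) //=; apply/idP/idP => [|AC].
    rewrite !inE => /andP[_ /andP[Ac /eqP cA]].
    rewrite -{1}cA (clique_subset cc0 Ac) /=.
    by apply: subset_trans Ac _; apply: setUS.
  rewrite !inE (cliques_in_adjoin_new eQ AC vA).
  have AQ : A != Q by apply: contraNneq vQ => <-.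
  by move: AC; rewrite !inE AQ => /andP[/cliqueP[-> _] _] /=.
have -> : cliques_in e k.+2 (v |: S) = (v |: Q) |: cliques_in e k.+2 S.
  apply/setP=> A; rewrite in_setU1; have [vA|vA] := boolP (v \in A).
    rewrite (contraTF (@old_v _ A)) // orbF; apply/idP/eqP => [AC|->].
      apply/eqP; rewrite eqEcard (cliques_in_adjoin_new eQ AC vA) card_c0.
      by move: AC; rewrite !inE => /andP[/cliqueP[-> _] _]; rewrite leqnn.
    by rewrite !in_set cc0 setUS.
  rewrite (cliques_in_adjoin_old _ _ _ vA).
  by case: eqP => // AE; rewrite AE setU11 in vA.
apply: (@has_diagonal_form_perm _ _ _
         (ktree_factors k m ++ 1 :: nseq k k.+2%:Z)).
  apply/seq.permP=> p; rewrite /ktree_factors !(count_cat, count_nseq) /= !count_nseq.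
  by rewrite mulSn mulnDr /=; lia.
apply: (facet_laplacian_glue _ _ Qa _ _ _ _ As) => //.
- exact: enum_uniq.
- by apply/negP=> /old_v; rewrite setU11.
- move=> a; rewrite aE => aC; have va := old_v _ _ aC.
  move: aC; rewrite !in_set => /andP[/cliqueP[ca _] _].
  apply/idP/eqP => [ac|->]; last exact: subsetUr.
  apply/eqP; rewrite eqEcard ca card_Q leqnn andbT; apply/subsetP=> x xa.
  by have := subsetP ac x xa; rewrite !inE => /predU1P[xv|//]; rewrite -xv xa in va.
- move=> b; rewrite newE => bn; split.
    by rewrite aE; apply/negP=> /old_v; rewrite new_v.
  by move: bn; rewrite !inE => /andP[_ /andP[]].
- move=> b C; rewrite newE => /new_v vb /old_v vC.
  by apply/negP=> /subsetP/(_ v vb); apply/negP.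
Qed.

Lemma rank_intr_equiv (n : nat) (A P Q : 'M[int]_n) :
  P \in unitmx -> Q \in unitmx ->
  \rank (map_mx intr (P *m A *m Q) : 'M[rat]_n) =
    \rank (map_mx intr A : 'M[rat]_n).
Proof.
move=> uP uQ.
have free (B : 'M[int]_n) : B \in unitmx -> row_free (map_mx intr B : 'M[rat]_n).
  by rewrite row_free_unit !unitmxE det_map_mx; apply: rmorph_unit.
rewrite !map_mxM mxrankMfree ?free //.
by rewrite -mxrank_tr trmx_mul mxrankMfree ?mxrank_tr // map_trmx free ?unitmx_tr.
Qed.

(** The unimodular factors preserve the rank over the rationals, so the number of
    nonzero diagonal entries is the rank of [A]. *)
Lemma smith_of_diagonal_form (n : nat) (A : 'M[int]_n) (f : seq int) (z : nat) :
  has_diagonal_form A (f ++ nseq z 0) ->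
  (forall i : nat, (i < size f)%N -> 0 < f`_i) ->
  (forall i j : nat, (i < j < size f)%N -> (f`_i %| f`_j)%Z) ->
  is_smith_normal_form A (diag_mx (\row_i (f ++ nseq z 0)`_i)).
Proof.
rewrite /has_diagonal_form size_cat size_nseq.
move=> [sz [P [Q [uP uQ E]]]] f_gt0 f_dvd.
have nthE i : (f ++ nseq z 0)`_i = f`_i.
  rewrite nth_cat; case: ltnP => // fi.
  by rewrite nth_nseq if_same nth_default.
have diagE : diag_mx (\row_(i < n) (f ++ nseq z 0)`_i) =
    \matrix_(i, j) (if i == j :> nat then f`_i else 0).
  by apply/matrixP=> i j; rewrite !mxE nthE -val_eqE /=; case: eqP.
split; first by exists P, Q; split.
exists f; split=> //.
rewrite -(rank_intr_equiv A uP uQ) E.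
subst n.
(* Replacing the zeros by ones splits off an invertible diagonal factor. *)
have -> : map_mx intr (diag_mx (\row_(i < size f + z) (f ++ nseq z 0)`_i)) =
    (pid_mx (size f) : 'M[rat]_(size f + z)) *m
      diag_mx (\row_i (if (i < size f)%N then (f`_i)%:~R else 1)).
  apply/matrixP=> i j; rewrite mul_mx_diag !mxE nthE -val_eqE /=.
  case: eqP => [->|_]; last by rewrite mul0r.
  case: ltnP => fj; rewrite /= ?mul1r //.
  by rewrite nth_default // mul0rn mul0r.
rewrite mxrankMfree ?rank_pid_mx ?leq_addr //.
rewrite row_free_unit unitmxE det_diag unitfE; apply/prodf_neq0=> i _.
by rewrite mxE; case: ifP => // /f_gt0/lt0r_neq0; rewrite intr_eq0.
Qed.

Lemma direct_sum_factorsE (k m c : nat) (E : (m + (m * k + 1))%N = c) :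
  castmx (E, E) (direct_sum_mx (1%:M : 'M[int]_m)
    (direct_sum_mx (k.+2%:Z *: 1%:M : 'M[int]_(m * k)) (0 : 'M[int]_1))) =
  diag_mx (\row_i (ktree_factors k m)`_i).
Proof.
subst c; rewrite castmx_id /direct_sum_mx scalemx1.
have -> : 0 = (0%:M : 'M[int]_1) by rewrite raddf0.
rewrite -!diag_const_mx -!diag_mx_row; congr diag_mx; apply/rowP=> i.
rewrite [RHS]mxE /ktree_factors !nth_cat !size_nseq !nth_nseq.
case: (split_ordP i) => j -> /=; first by rewrite row_mxEl mxE.
rewrite row_mxEr addKn.
case: (split_ordP j) => j' -> /=; first by rewrite row_mxEl mxE.
by rewrite row_mxEr mxE addKn ord1.
Qed.

Theorem theorem11 (V : finType) (e : rel V) (k n : nat)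
    (e_sym : symmetric e) (e_irr : irreflexive e)
    (k_ge1 : (1 <= k)%N) (T_ktree : ktree e k)
    (card_V : #|V| = n) (n_gt_k : (n > k)%N)
    (c : nat) (alpha : c.-tuple {set V})
    (alpha_uniq : uniq alpha) (alpha_cliques : alpha =i cliques e k) :
  exists Ec : ((n - k) + ((n - k) * (k - 1) + 1) = c)%N,
    is_smith_normal_form (clique_laplacian e k alpha)
      (castmx (Ec, Ec)
        (direct_sum_mx (1%:M : 'M[int]_(n - k))
          (direct_sum_mx (k.+1%:Z *: 1%:M : 'M[int]_((n - k) * (k - 1)))
            (0 : 'M[int]_1)))).
Proof.
case: k k_ge1 T_ktree n_gt_k alpha_cliques => // k _ T_ktree n_gt_k alphaE.
have [m [c' [beta [cV ub bE beta_form]]]] :=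
  ktree_on_laplacian_form e_sym T_ktree.
have cliques_inT d : cliques_in e d [set: V] = cliques e d.
  by apply/setP=> A; rewrite !in_set subsetT andbT.
rewrite !cliques_inT in bE beta_form.
have perm_ba : perm_eq beta alpha.
  by apply: uniq_perm => // A; rewrite bE alphaE.
have cc : c' = c by rewrite -(size_tuple beta) (perm_size perm_ba) size_tuple.
subst c'.
have alpha_form := facet_laplacian_perm perm_ba beta_form.
rewrite -clique_laplacianE // in alpha_form; last by move=> A; rewrite alphaE.
have -> : (n - k.+1 = m)%N by rewrite -card_V -cardsT cV addKn.
rewrite subn1 /=.
have Ec : (m + (m * k + 1))%N = c.
  by have [sz _] := alpha_form; rewrite -sz !size_cat !size_nseq.
exists Ec; rewrite direct_sum_factorsE /ktree_factors.
rewrite /ktree_factors catA in alpha_form *.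
apply: (smith_of_diagonal_form (z := 1)) => //.
- move=> i; rewrite size_cat !size_nseq nth_cat size_nseq !nth_nseq => im.
  by case: (ltnP i m) => // mi; rewrite ltn_subLR // im.
- move=> i j /andP[ij]; rewrite size_cat !size_nseq => jm.
  rewrite !nth_cat !size_nseq !nth_nseq.
  case: (ltnP i m) => [_|mi]; first exact: dvd1z.
  have mj : (m <= j)%N := leq_trans mi (ltnW ij).
  by rewrite ltnNge mj /= !ltn_subLR // jm (ltn_trans ij jm) dvdzz.
Qed.
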